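(* Let $m>1$ be an odd integer divisible by $3$. Then the elliptic curve over $\mathbf{Q}$ given by \[ E_m \colon y^2 = x^3 - x + m^6 \] has rank at least $3$.
   Context: The rank of an elliptic curve $E/\mathbf{Q}$ is the integer $r\ge 0$ such that $E(\mathbf{Q}) \simeq \mathbf{Z}^r \oplus T$ with $T$ a finite abelian group (Mordell-Weil theorem). *)

(* Defs.v *)
From mathcomp Require Import all_boot all_order all_algebra.
From mathcomp Require Import ring lra.

Set Implicit Arguments.
Unset Strict Implicit.
Unset Printing Implicit Defensive.

Import Order.TTheory GRing.Theory Num.Theory.
Local Open Scope ring_scope.

(* y^2 = x^3 + a x + b; every elliptic curve over Q has such a model. *)
Record elliptic_curve := EllipticCurve {
  ec_a : rat;
  ec_b : rat;
  ec_nonsingular : 4 * ec_a ^+ 3 + 27 * ec_b ^+ 2 != 0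
}.

Inductive point := Infinity | Affine (x y : rat).

Definition on_curve (E : elliptic_curve) (P : point) : bool :=
  match P with
  | Infinity => true
  | Affine x y => y ^+ 2 == x ^+ 3 + ec_a E * x + ec_b E
  end.

(* Chord-and-tangent law. On points of E, the slope in the case x1 = x2 is only
   used when y1 = y2 != 0. *)
Definition point_add (E : elliptic_curve) (P Q : point) : point :=
  match P, Q with
  | Infinity, _ => Q
  | _, Infinity => P
  | Affine x1 y1, Affine x2 y2 =>
    if (x1 == x2) && (y1 == - y2) then Infinity else
    let l := if x1 == x2 then (3 * x1 ^+ 2 + ec_a E) / (2 * y1)
             else (y2 - y1) / (x2 - x1) in
    let x3 := l ^+ 2 - x1 - x2 in
    Affine x3 (l * (x1 - x3) - y1)
  end.

Lemma point_add_on_curve (E : elliptic_curve) (P Q : point) :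
  on_curve E P -> on_curve E Q -> on_curve E (point_add E P Q).
Proof.
case: P => [|x1 y1] //; case: Q => [|x2 y2] //= /eqP h1 /eqP h2.
have [e|ne] := eqVneq x1 x2 => /=.
  subst x2; have [//|ny] := eqVneq y1 (- y2) => /=.
  have ey : y2 = y1.
    apply/eqP; rewrite eq_sym -subr_eq0.
    have : (y1 - y2) * (y1 + y2) = 0 by ring: h1 h2.
    by move/eqP; rewrite mulf_eq0 (addr_eq0 y1 y2) (negbTE ny) orbF.
  subst y2.
  have y0 : y1 != 0 by apply: contraNneq ny => ->; rewrite oppr0.
  have hb : ec_b E = y1 ^+ 2 - x1 ^+ 3 - ec_a E * x1 by ring: h1.
  by apply/eqP; rewrite hb; field.
have d0 : x2 - x1 != 0 by rewrite subr_eq0 eq_sym.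
set l := (y2 - y1) / (x2 - x1).
have hl : y2 = y1 + l * (x2 - x1) by rewrite /l; field.
have hb : ec_b E = y1 ^+ 2 - x1 ^+ 3 - ec_a E * x1 by ring: h1.
have ha : ec_a E = 2 * y1 * l + l ^+ 2 * (x2 - x1)
                   - (x1 ^+ 2 + x1 * x2 + x2 ^+ 2).
  have h : (x2 - x1) * ec_a E = y2 ^+ 2 - x2 ^+ 3 - y1 ^+ 2 + x1 ^+ 3.
    by ring: h1 h2.
  by apply: (mulfI d0); rewrite h hl; ring.
by apply/eqP; rewrite hb ha; ring.
Qed.

Definition rational_points (E : elliptic_curve) : Type :=
  {P : point | on_curve E P}.

Definition rational_points_add (E : elliptic_curve) (P Q : rational_points E) :
    rational_points E :=
  exist _ (point_add E (sval P) (sval Q))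
    (point_add_on_curve (svalP P) (svalP Q)).

(* E(Q) is isomorphic to Z^r (+) T for some finite abelian group T. *)
Definition has_rank (E : elliptic_curve) (r : nat) : Prop :=
  exists (T : finZmodType) (f : rational_points E -> ('rV[int]_r * T)%type),
    bijective f /\
    forall P Q : rational_points E, f (rational_points_add P Q) = f P + f Q.

Lemma Em_nonsingular (m : nat) :
  4 * (-1) ^+ 3 + 27 * ((m%:R : rat) ^+ 6) ^+ 2 != 0 :> rat.
Proof.
case: m => [|m]; first by rewrite expr0n /=.
have h : 1 <= (m.+1%:R : rat) ^+ 12 by rewrite exprn_ege1 // ler1n.
by apply: lt0r_neq0; rewrite -exprM; lra.
Qed.

Definition Em (m : nat) : elliptic_curve :=
  EllipticCurve (Em_nonsingular m).

(* Main.v *)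
(* A = (0, -m^3), B = (1, -m^3) and C = (-m^2, m) lie on the curve. As x^3 - x
   is even for integral x and m is odd, there is no rational 2-torsion, so
   E(Q)/2E(Q) has order 2^r, and it suffices that none of the seven nonempty
   subset sums of A, B, C is a double. If (n/e^2, k/e^3) is a double, the slope
   of the tangent at a half is s/e with s an integer and
   s^4 - 6 n s^2 - 8 k s - 3 n^2 + 4 e^4 = 0.
   All the sums but A + C are integral points with 3 | k, and then the equation
   reads s^4 + 1 = 0 modulo 3; for A + C, where e = m, it has no solution
   modulo 8. *)
Require Import Defs.
From mathcomp Require Import all_boot all_order all_algebra.
From mathcomp Require Import ring lra zify.

Import Order.TTheory GRing.Theory Num.Theory.
Local Open Scope ring_scope.

(** Rational root theorem: the denominator divides the fourth power of the numerator, to which it is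
    coprime. *)
Lemma quartic_int_root (a b c : int) (x : rat) :
  x ^+ 4 + a%:~R * x ^+ 2 + b%:~R * x + c%:~R = 0 -> exists z : int, x = z%:~R.
Proof.
rewrite -[x in X in X -> _]divq_num_den => h.
have q0 : (denq x)%:~R != 0 :> rat by rewrite intr_eq0 denq_neq0.
set p := numq x in h; set q := denq x in h q0.
have e : p ^+ 4 = q * - (a * p ^+ 2 * q + b * p * q ^+ 2 + c * q ^+ 3).
  apply: (intr_inj (R := rat)); apply: subr0_eq.
  by rewrite -(mulr0 (q%:~R ^+ 4)) -h; field.
have : (q %| 1)%Z.
  rewrite -(@Gauss_dvdzr _ (p ^+ 4)) ?mulr1; first by rewrite e dvdz_mulr.
  by rewrite coprimez_pexpr // coprimez_sym /coprimez; apply: coprime_num_den.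
rewrite dvdz1 => /eqP q1.
by apply/intrP; rewrite Qint_def -absz_denq q1.
Qed.

Lemma F3_fourth_power_add1_neq0 (x : 'F_3) : x ^+ 4 + 1 != 0.
Proof. by case: x => [[|[|[|//]]] ?]. Qed.

(** [n / m ^+ 2] has the shape of the abscissa of A + C, and the term [8 k s] has dropped out modulo
    8. As [m ^+ 2 = 1] and [n = 5] here, the quartic is [(s ^+ 2 + 1) ^+ 2], and 4 never divides
    [s ^+ 2 + 1]. *)
Lemma Z8_quartic_neq0 (s j : 'Z_8) :
  let m := 2 * j + 1 in let n := 2 * m ^+ 4 + 2 * m ^+ 2 + 1 in
  s ^+ 4 - 6 * n * s ^+ 2 - 3 * n ^+ 2 + 4 * m ^+ 4 != 0.
Proof.
by case: s j => [[|[|[|[|[|[|[|[|//]]]]]]]] ?] [[|[|[|[|[|[|[|[|//]]]]]]]] ?].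
Qed.

(* [l] is the slope of the tangent at [Q]; the quartic is the discriminant of
   the residual intersection of a line of slope [l] through the negative of the
   double, which vanishes exactly when the line is tangent. *)
Lemma double_slope (E : elliptic_curve) (Q : point) (x y : rat) :
  point_add E Q Q = Affine x y ->
  exists l, l ^+ 4 - 6 * x * l ^+ 2 - 8 * y * l - 3 * x ^+ 2 - 4 * ec_a E = 0.
Proof.
case: Q => [//|u v] /=; rewrite eqxx /=.
case: eqVneq => [//|nv] [<- <-].
have v0 : v != 0 by apply: contraNneq nv => ->; rewrite oppr0.
by exists ((3 * u ^+ 2 + ec_a E) / (2 * v)); field.
Qed.

Lemma Em_double_int_root (m : nat) (Q : point) (e n k : int) :
  e != 0 ->
  point_add (Em m) Q Q = Affine (n%:~R / e%:~R ^+ 2) (k%:~R / e%:~R ^+ 3) ->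
  exists s : int,
    s ^+ 4 - 6 * n * s ^+ 2 - 8 * k * s - 3 * n ^+ 2 + 4 * e ^+ 4 = 0.
Proof.
move=> e0 /double_slope [l /= hl].
have e0' : e%:~R != 0 :> rat by rewrite intr_eq0.
(* Scaling the slope by [e] clears denominators and keeps the quartic monic. The variable [t] serves
   twice: for [l * e] itself, then for the integer that it equals. *)
have h t : t = l * e%:~R -> t ^+ 4 + (- 6 * n)%:~R * t ^+ 2
    + (- 8 * k)%:~R * t + (- 3 * n ^+ 2 + 4 * e ^+ 4)%:~R = 0.
  by move=> ->; rewrite -[RHS](mulr0 (e%:~R ^+ 4)) -hl; field.
have [s /esym hs] := quartic_int_root _ _ _ _ (h _ erefl).
exists s; apply: (intr_inj (R := rat)); rewrite -[RHS](h _ hs); ring.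
Qed.

Lemma Em_not_double_of_dvd3 (m : nat) (Q : point) (n k : int) :
  point_add (Em m) Q Q <> Affine n%:~R (3 * k)%:~R.
Proof.
(* Denominators are introduced as powers of 1, to match [e = 1]. *)
rewrite -[n%:~R]divr1 -[(3 * k)%:~R]divr1 -(expr1n _ 2) -{2}(expr1n _ 3).
move=> /(@Em_double_int_root m Q 1 n (3 * k) isT) [s hs].
have {hs} : s ^+ 4 + 1
    = 3 * (2 * n * s ^+ 2 + 8 * k * s + n ^+ 2 - 1).
  by apply: subr0_eq; rewrite -[RHS]hs; ring.
move/(congr1 (intr : int -> 'F_3)).
rewrite rmorphD rmorphXn rmorph1 rmorphM rmorph_nat (_ : 3%:R = 0); last exact/eqP.
by rewrite mul0r => /eqP; rewrite (negbTE (F3_fourth_power_add1_neq0 _)).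
Qed.

Lemma Em_not_double_of_mod8 (m : nat) (Q : point) (a k : int) :
  let b := 2 * a + 1 in
  point_add (Em m) Q Q <>
  Affine ((2 * b ^+ 4 + 2 * b ^+ 2 + 1)%:~R / b%:~R ^+ 2) (k%:~R / b%:~R ^+ 3).
Proof.
move=> b /Em_double_int_root [|s].
  by apply/eqP; rewrite /b; lia.
set n := 2 * b ^+ 4 + 2 * b ^+ 2 + 1 => hs.
have {hs} : s ^+ 4 - 6 * n * s ^+ 2 - 3 * n ^+ 2 + 4 * b ^+ 4 = 8 * (k * s).
  by apply: subr0_eq; rewrite -[RHS]hs; ring.
move/(congr1 (intr : int -> 'Z_8)).
rewrite (rmorphM _ 8) rmorph_nat (_ : 8%:R = 0); last exact/eqP.
rewrite mul0r => /eqP; apply/negP.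
have := Z8_quartic_neq0 s%:~R a%:~R; congr (_ != 0).
by rewrite /n /b; ring.
Qed.

Lemma Em_double_eq_Infinity (m : nat) (Q : point) :
  odd m -> on_curve (Em m) Q -> point_add (Em m) Q Q = Infinity ->
  Q = Infinity.
Proof.
case: Q => [//|x y] modd /= /eqP hx; rewrite eqxx /=.
case: eqVneq => [y0|//] _; have {y0} y0 : y = 0 by lra.
have {y0}hx : x ^+ 3 - x + m%:R ^+ 6 = 0.
  have -> : x ^+ 3 - x + m%:R ^+ 6 = y ^+ 2 by rewrite hx; ring.
  by rewrite y0 expr0n.
(* The cubic times [x] is a monic quartic, so [x] is an integer; modulo 2 the cubic takes only the
   value 1. *)
have [] := quartic_int_root (- 1) (m%:Z ^+ 6) 0 x.
  by rewrite -[RHS](mulr0 x) -hx; ring.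
move=> z xz; exfalso.
have : z ^+ 3 - z + m%:Z ^+ 6 = 0.
  by apply: (intr_inj (R := rat)); rewrite -[RHS]hx xz; ring.
move/(congr1 (intr : int -> 'F_2)).
rewrite rmorphD rmorphB !rmorphXn /= (_ : m%:Z%:~R = 1 :> 'F_2).
  by case: (_%:~R) => [[|[|//]] ?].
rewrite -pmulrn -(odd_double_half m) modd -mul2n natrD natrM.
by rewrite (_ : 2%:R = 0) ?mul0r ?addr0 //; apply/eqP.
Qed.

(* A point [2 h] is invisible modulo 2, and [T = 2 T] when [T] has no element of
   order 2, so the parity vectors of the [2 ^ n] subset sums are distinct. *)
Lemma rank_ge_of_independent_mod2 (r n : nat) (T : finZmodType)
    (g : 'I_n -> 'rV[int]_r * T) :
  (forall t : T, t + t = 0 -> t = 0) ->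
  (forall (u : 'I_n -> bool) h, \sum_i g i *+ u i = h + h -> forall i, ~~ u i) ->
  (n <= r)%N.
Proof.
move=> T2 ind.
have half (v : 'rV[int]_r * T) :
    (forall j, (2 %| v.1 0%R j)%Z) -> exists h, v = h + h.
  case: v => v t /= ev.
  have inj2 : injective (fun t : T => t + t).
    move=> x y /= /eqP; rewrite -subr_eq0 opprD addrACA => /eqP /T2 /eqP.
    by rewrite subr_eq0 => /eqP.
  have [d _ dK] := injF_bij inj2.
  exists (\row_j (v 0%R j %/ 2)%Z, d t); congr pair; last by rewrite dK.
  by apply/rowP => j; have := ev j; rewrite !mxE; lia.
pose S (u : {ffun 'I_n -> bool}) := \sum_i g i *+ u i.
pose p u := [ffun j => (2 %| (S u).1 0%R j)%Z].
have p_inj : injective p.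
  move=> u v /ffunP puv; apply/ffunP => i.
  have /half [h hh] j : (2 %| (S u - S v).1 0%R j)%Z.
    have := puv j; rewrite !ffunE.
    have -> : (S u - S v).1 0%R j = (S u).1 0%R j - (S v).1 0%R j.
      by rewrite [LHS]mxE [X in _ + X]mxE.
    by move: ((S u).1 0%R j) ((S v).1 0%R j) => x y; lia.
  (* The symmetric difference is [u - v] plus twice the indicator of [~~ u && v], so its subset sum
     is a double as soon as [S u - S v] is. *)
  pose w i := u i (+) v i.
  suff e : \sum_i g i *+ w i
      = (h + \sum_i g i *+ (~~ u i && v i)) + (h + \sum_i g i *+ (~~ u i && v i)).
    by have := ind w _ e i; rewrite /w; case: (u i); case: (v i).
  rewrite addrACA -hh -!big_split -sumrB -big_split; apply: eq_bigr => {}i _ /=.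
  rewrite /w; case: (u i); case: (v i) => /=;
    rewrite ?mulr0n ?mulr1n ?subrr ?addr0 ?subr0 //.
  by rewrite sub0r addKr.
have := leq_card p p_inj.
by rewrite !card_ffun card_bool !card_ord leq_exp2l.
Qed.

(** The slope is a parameter, so that its simplified value can be supplied for each sum. *)
Lemma point_add_chord (E : elliptic_curve) (l x1 y1 x2 y2 : rat) :
  x1 != x2 -> y2 - y1 = l * (x2 - x1) ->
  point_add E (Affine x1 y1) (Affine x2 y2)
    = Affine (l ^+ 2 - x1 - x2) (l * (x1 - (l ^+ 2 - x1 - x2)) - y1).
Proof.
move=> ne hl; have d0 : x2 - x1 != 0 by rewrite subr_eq0 eq_sym.
by rewrite /= (negbTE ne) /= hl mulfK.
Qed.

Local Close Scope ring_scope.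

Theorem theorem1p1 (m : nat) (hm : 1 < m) (hodd : odd m) (h3 : 3 %| m)
    (r : nat) (hr : has_rank (Em m) r) : 3 <= r.
Proof.
Local Open Scope ring_scope.
case: hr => T [f [[f' fK f'K] fD]].
pose M : rat := m%:R.
have M0 : M != 0 by rewrite pnatr_eq0; lia.
have M1 : 1 < M by rewrite ltr1n.
have [c mc] : exists c : int, M = (3 * c)%:~R.
  by case/dvdnP: h3 => c mc; exists c%:Z; rewrite /M mc; ring.
have [a ma] : exists a : int, M = (2 * a + 1)%:~R.
  have em : m = (2 * m./2 + 1)%N by lia.
  by exists (m./2)%:Z; rewrite /M [in LHS]em; ring.
have onA : on_curve (Em m) (Affine 0 (- M ^+ 3)) by apply/eqP => /=; rewrite -/M; ring.
have onB : on_curve (Em m) (Affine 1 (- M ^+ 3)) by apply/eqP => /=; rewrite -/M; ring.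
have onC : on_curve (Em m) (Affine (- M ^+ 2) M) by apply/eqP => /=; rewrite -/M; ring.
pose A : rational_points (Em m) := exist (on_curve (Em m)) _ onA.
pose B : rational_points (Em m) := exist (on_curve (Em m)) _ onB.
pose C : rational_points (Em m) := exist (on_curve (Em m)) _ onC.
pose O : rational_points (Em m) := exist (on_curve (Em m)) Infinity isT.
have f_double P h : f P = h + h -> exists Q, rational_points_add Q Q = P.
  by move=> fP; exists (f' h); apply: (can_inj fK); rewrite fD f'K -fP.
have fO : f O = 0.
  have : f O + f O = f O by rewrite -fD; congr f; apply: val_inj.
  by move/(canRL (addrK _)); rewrite subrr.
(* Such a [t] comes from a rational point killed by doubling, which can only be [O]. *)
have T2 (t : T) : t + t = 0 -> t = 0.
  move=> t2; have ff : f (f' (0, t)) + f (f' (0, t)) = 0.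
    by rewrite f'K; congr pair; rewrite ?addr0.
  have /(congr1 sval) /= : rational_points_add (f' (0, t)) (f' (0, t)) = O.
    by apply: (can_inj fK); rewrite fD ff fO.
  move/(Em_double_eq_Infinity _ _ hodd (svalP (f' (0, t)))) => Q0.
  have {Q0} : f' (0, t) = O by apply: val_inj.
  by move/(congr1 f); rewrite f'K fO => -[].
have not_double P x y n k h : sval P = Affine x y ->
    x = n%:~R -> y = (3 * k)%:~R -> f P <> h + h.
  move=> sP xn yk /f_double [Q /(congr1 sval)] /=.
  by rewrite sP xn yk; apply: Em_not_double_of_dvd3.
have AB : point_add (Em m) (Affine 0 (- M ^+ 3)) (Affine 1 (- M ^+ 3))
    = Affine (- 1) (M ^+ 3).
  by rewrite (point_add_chord _ 0) //; [congr Affine|]; ring.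
have AC : point_add (Em m) (Affine 0 (- M ^+ 3)) (Affine (- M ^+ 2) M)
    = Affine ((2 * M ^+ 4 + 2 * M ^+ 2 + 1) / M ^+ 2)
        (((1 + M ^+ 2) * (2 * M ^+ 4 + 2 * M ^+ 2 + 1) + M ^+ 6) / M ^+ 3).
  rewrite (point_add_chord _ (- (1 + M ^+ 2) / M)); last by field.
    by congr Affine; field.
  by rewrite eq_sym oppr_eq0 expf_neq0.
have BC : point_add (Em m) (Affine 1 (- M ^+ 3)) (Affine (- M ^+ 2) M)
    = Affine (2 * M ^+ 2 - 1) (3 * M ^+ 3 - 2 * M).
  rewrite (point_add_chord _ (- M)); last by ring.
    by congr Affine; ring.
  by apply/eqP; nra.
(* The abscissas [- 1] and [- M ^+ 2] differ because [M > 1]. *)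
have ABC : point_add (Em m) (Affine (- 1) (M ^+ 3)) (Affine (- M ^+ 2) M)
    = Affine (2 * M ^+ 2 + 1) (- (3 * M ^+ 3 + 2 * M)).
  rewrite (point_add_chord _ M); last by ring.
    by congr Affine; ring.
  by apply/eqP; nra.
(* With [M = 3 c], the witnesses here and below are the abscissa and a third of the ordinate. *)
have nA h : f A <> h + h.
  by apply: (not_double _ _ _ 0 (- 9 * c ^+ 3)); rewrite ?mc //; ring.
have nB h : f B <> h + h.
  by apply: (not_double _ _ _ 1 (- 9 * c ^+ 3)); rewrite ?mc //; ring.
have nC h : f C <> h + h.
  by apply: (not_double _ _ _ (- 9 * c ^+ 2) c); rewrite ?mc //; ring.
have nAB h : f A + f B <> h + h.
  rewrite -fD; apply: (not_double _ _ _ (- 1) (9 * c ^+ 3)); first exact: AB.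
    by ring.
  by rewrite mc; ring.
have nAC h : f A + f C <> h + h.
  rewrite -fD => /f_double [Q /(congr1 sval) QQ].
  (* The last argument is the numerator of the ordinate in [AC], with [M = 2 a + 1]. *)
  have := Em_not_double_of_mod8 m (sval Q) a
    ((1 + (2 * a + 1) ^+ 2) * (2 * (2 * a + 1) ^+ 4 + 2 * (2 * a + 1) ^+ 2 + 1)
      + (2 * a + 1) ^+ 6).
  apply; rewrite -ma; apply: etrans QQ (etrans AC _).
  by rewrite ma; congr (Affine (_ / _) (_ / _)); ring.
have nBC h : f B + f C <> h + h.
  rewrite -fD; apply: (not_double _ _ _ (18 * c ^+ 2 - 1) (27 * c ^+ 3 - 2 * c)).
  - exact: BC.
  - by rewrite mc; ring.
  - by rewrite mc; ring.
have nABC h : f A + f B + f C <> h + h.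
  rewrite -!fD; apply: (not_double _ _ _ (18 * c ^+ 2 + 1) (- 27 * c ^+ 3 - 2 * c)).
  - exact: etrans (congr1 (point_add (Em m) ^~ _) AB) ABC.
  - by rewrite mc; ring.
  - by rewrite mc; ring.
have := rank_ge_of_independent_mod2 r 3 T (tnth [tuple f A; f B; f C]) T2.
apply=> u h; rewrite !big_ord_recl big_ord0 !(tnth_nth 0) /= addr0 => e.
have {e} [u0 u1 u2] : [/\ ~~ u ord0, ~~ u (lift ord0 ord0)
    & ~~ u (lift ord0 (lift ord0 ord0))].
  move: e; do 3 case: (u _) => //=; rewrite ?mulr0n ?mulr1n ?add0r ?addr0 ?addrA.
  - by move/nABC.
  - by move/nAB.
  - by move/nAC.
  - by move/nA.
  - by move/nBC.
  - by move/nB.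
  - by move/nC.
case=> [[|[|[|//]]]] i.
- by rewrite (_ : Ordinal i = ord0) //; apply: val_inj.
- by rewrite (_ : Ordinal i = lift ord0 ord0) //; apply: val_inj.
- by rewrite (_ : Ordinal i = lift ord0 (lift ord0 ord0)) //; apply: val_inj.
Qed.
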